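(* Let $A$ be a real or complex $n\times d$ matrix with full column rank that admits an $(m,\alpha,\beta)$ row paving $T=\{\tau_1,\dots,\tau_m\}$ with $\alpha>0$. Let $b$ be a vector of dimension $n$, and consider the least-squares problem $$\text{minimize}\quad \|Ax-b\|_2^2 .$$ Let $x_\star$ be its unique minimizer, and define the residual $e:=Ax_\star-b$. Then for any initial estimate $x_0$, the sequence $\{x_j: j\ge 0\}$ of iterates produced by the randomized block Kaczmarz method with matrix $A$, right-hand side $b$, partition $T$ and initial iterate $x_0$ satisfies, for every $j\ge 0$, $$ \mathbb{E}\,\|x_j-x_\star\|_2^2 \;\le\; \left[1-\frac{\sigma_{\min}^2(A)}{\beta m}\right]^{j}\|x_0-x_\star\|_2^2 \;+\; \frac{\beta}{\alpha}\cdot\frac{\|e\|_2^2}{\sigma_{\min}^2(A)} . $$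
   Context: For an index set $\tau\subset\{1,\dots,n\}$, $A_\tau$ is the row submatrix of $A$ with rows indexed by $\tau$, and $b_\tau$ is the subvector of $b$ with components listed in $\tau$. The symbol $\dagger$ denotes the Moore--Penrose pseudoinverse and $*$ the conjugate transpose. $\sigma_{\min}(A)$ is the smallest singular value of $A$, i.e. the $\min\{n,d\}$-th singular value in decreasing order. Row paving: an $(m,\alpha,\beta)$ row paving of $A$ is a partition $T=\{\tau_1,\dots,\tau_m\}$ of the row indices $\{1,\dots,n\}$ such that $\alpha\le\lambda_{\min}(A_\tau A_\tau^* )$ and $\lambda_{\max}(A_\tau A_\tau^* )\le\beta$ for each $\tau\in T$, where $\lambda_{\min},\lambda_{\max}$ are the minimum and maximum eigenvalues of a Hermitian matrix. Randomized block Kaczmarz method: start from a fixed $x_0$. At each iteration $j=1,2,\dots$, independently of all previous choices, draw a block $\tau=\tau(j)$ uniformly at random from $T$ and set $$x_j = x_{j-1}+(A_\tau)^\dagger\,(b_\tau-A_\tau x_{j-1}).$$ The sequence of iterates is considered without applying any stopping criterion. The expectation is over the random block choices. *)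

(* Defs.v *)
From mathcomp Require Import all_boot all_order all_algebra.
From mathcomp Require Import all_classical all_reals all_analysis.
From mathcomp.real_closed Require Import complex.

Set Implicit Arguments.
Unset Strict Implicit.
Unset Printing Implicit Defensive.

Import Order.TTheory GRing.Theory Num.Theory.

Local Open Scope classical_set_scope.
Local Open Scope ring_scope.

Variant scalar_kind := RealScalars | ComplexScalars.

Definition scalars (R : realType) (k : scalar_kind) : numFieldType :=
  match k with
  | RealScalars => R
  | ComplexScalars => R[i]
  end.

Definition sconj (R : realType) (k : scalar_kind) : scalars R k -> scalars R k :=
  match k with
  | RealScalars => fun x => x
  | ComplexScalars => fun z : R[i] => Num.conj z
  end.

Definition sre (R : realType) (k : scalar_kind) : scalars R k -> R :=
  match k with
  | RealScalars => fun x => x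
  | ComplexScalars => fun z : R[i] => complex.Re z
  end.

Section LinearAlgebra.
Context {R : realType} {k : scalar_kind}.
Local Notation K := (scalars R k).

Definition adjmx p q (A : 'M[K]_(p, q)) : 'M[K]_(q, p) :=
  (map_mx (@sconj R k) A)^T.

Definition sqnorm p (v : 'cV[K]_p) : R := \sum_i sre `|v i 0| ^+ 2.

(* The eigenvalues used below belong to Hermitian matrices: they are real,
   so they are comparable for the partial order of R[i] and [sre] loses
   nothing. *)
Definition lambda_min p (M : 'M[K]_p) : R :=
  sre (xget 0 [set l | eigenvalue M l /\ forall mu, eigenvalue M mu -> l <= mu]).

Definition lambda_max p (M : 'M[K]_p) : R :=
  sre (xget 0 [set l | eigenvalue M l /\ forall mu, eigenvalue M mu -> mu <= l]).

(* Square roots of the eigenvalues of A^* A with multiplicity, in decreasing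
   order. This list has q entries, so for p < q it ends with q - p zeros, which
   the index minn p q in [sigma_min] skips. *)
Definition is_singular_values p q (A : 'M[K]_(p, q)) (s : seq K) : Prop :=
  [/\ sorted (fun x y => y <= x) s,
      all (fun x => 0 <= x) s
    & char_poly (adjmx A *m A) = \prod_(x <- s) ('X - (x ^+ 2)%:P)].

Definition singular_values p q (A : 'M[K]_(p, q)) : seq K :=
  xget [::] [set s | is_singular_values A s].

Definition sigma_min p q (A : 'M[K]_(p, q)) : R :=
  sre (nth 0 (singular_values A) (minn p q).-1).

Definition is_moore_penrose p q (A : 'M[K]_(p, q)) (B : 'M[K]_(q, p)) : Prop :=
  [/\ A *m B *m A = A, B *m A *m B = B,
      adjmx (A *m B) = A *m B & adjmx (B *m A) = B *m A].

Definition moore_penrose p q (A : 'M[K]_(p, q)) : 'M[K]_(q, p) :=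
  xget 0 [set B | is_moore_penrose A B].

Definition row_block n q (A : 'M[K]_(n, q)) (tau : {set 'I_n}) :
    'M[K]_(#|tau|, q) :=
  rowsub (fun i : 'I_#|tau| => enum_val i) A.

Definition row_paving n d (A : 'M[K]_(n, d)) (m : nat) (alpha beta : R)
    (T : {set {set 'I_n}}) : Prop :=
  [/\ finset.partition T [set: 'I_n]%SET, #|T| = m
    & forall tau, tau \in T ->
        let G := row_block A tau *m adjmx (row_block A tau) in
        alpha <= lambda_min G /\ lambda_max G <= beta].

Definition least_squares_minimizer n d (A : 'M[K]_(n, d)) (b : 'cV[K]_n)
    (x : 'cV[K]_d) : Prop :=
  forall y : 'cV[K]_d, sqnorm (A *m x - b) <= sqnorm (A *m y - b).

(* [tau j] is the block used in iteration j + 1. *)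
Fixpoint block_kaczmarz n d (A : 'M[K]_(n, d)) (b : 'cV[K]_n) (x0 : 'cV[K]_d)
    (tau : nat -> {set 'I_n}) (j : nat) : 'cV[K]_d :=
  if j is i.+1 then
    let x := block_kaczmarz A b x0 tau i in
    x + moore_penrose (row_block A (tau i))
          *m (row_block b (tau i) - row_block A (tau i) *m x)
  else x0.

End LinearAlgebra.

Definition iid_uniform (R : realType) (n : nat) (disp : measure_display)
    (Omega : measurableType disp) (P : probability Omega R)
    (T : {set {set 'I_n}}) (tau : nat -> Omega -> {set 'I_n}) : Prop :=
  [/\ forall j t, measurable [set w | tau j w = t],
      forall j t, t \in T -> P [set w | tau j w = t] = ((#|T|%:R)^-1)%:E
    & forall (J : seq nat) (B : nat -> {set {set 'I_n}}), uniq J ->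
        P [set w | forall j, j \in J -> tau j w \in B j]
        = (\prod_(j <- J) P [set w | tau j w \in B j])%E].

(* Main.v *)
Require Import Defs.
From HB Require Import structures.
From mathcomp Require Import all_boot all_order all_algebra.
From mathcomp Require Import all_classical all_reals all_analysis.
From mathcomp.real_closed Require Import complex.
From mathcomp Require Import measurable_realfun ring lra.

(** Write [u] for the error of the current iterate and [e] for the residual
    [A xstar - b].  Processing the block [t] replaces [u] by
    [(1 - At^+ At) u - At^+ e_t], where [At^+] is the pseudoinverse of the block
    [At] of [A].  These two vectors are orthogonal, since the first is
    orthogonal to the row space of [At] and the second lies in it, so that
    [|u'|^2 = |u|^2 - |At^+ At u|^2 + |At^+ e_t|^2] ([sqnorm_block_step]).
    The paving makes [At At^*] invertible, with spectrum between [alpha] and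
    [beta], whence [|At^+ At u|^2 >= |At u|^2 / beta] ([sqnorm_mulmx_le]) and
    [|At^+ e_t|^2 <= |e_t|^2 / alpha] ([sqnorm_moore_penrose_le]).  As the blocks
    partition the rows, averaging over [t] turns the block norms into
    [|A u|^2 / m >= sigma_min^2 |u|^2 / m] and [|e|^2 / m]; this is the one-step
    estimate [kaczmarz_step_average],
    [avg |u'|^2 <= q |u|^2 + |e|^2 / (alpha m)] with
    [q = 1 - sigma_min^2 / (beta m)].

    The block drawn at a given step is uniform and independent of the earlier
    ones, hence of the current iterate, so the estimate holds between
    successive expectations ([expectation_next_block]).  The constant
    [beta |e|^2 / (alpha sigma_min^2)] is the fixed point of
    [c |-> q c + |e|^2 / (alpha m)], and [q >= 0]; the claimed bound follows by
    induction on the number of steps.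

    What the eigenvalues and singular values of the statement say about vectors
    is drawn from the spectral theorem in the form [hermitian_spectrum]: a
    Hermitian matrix has a real spectrum [r], and its quadratic form at [v] is
    a combination of the [r i] whose nonnegative weights sum to [|v|^2].  This
    form speaks of real numbers only, which lets the real case follow from the
    complex one. *)

Set Implicit Arguments.
Unset Strict Implicit.
Import Order.TTheory GRing.Theory Num.Theory.
Local Open Scope ring_scope.

(** * Real and complex scalars *)

Section Scalars.
Context {R : realType} {k : scalar_kind}.
Local Notation K := (scalars R k).
Implicit Types (x y : K) (r s : R).

Definition real_scalar : R -> K :=
  match k return R -> scalars R k with
  | RealScalars => fun r => r
  | ComplexScalars => fun r => (r%:C)%C
  end.

Fact real_scalar_zmod_morphism : zmod_morphism real_scalar.
Proof. by rewrite /real_scalar; case: k => // r s; rewrite rmorphB. Qed.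
HB.instance Definition _ :=
  GRing.isZmodMorphism.Build R K real_scalar real_scalar_zmod_morphism.

Fact real_scalar_monoid_morphism : monoid_morphism real_scalar.
Proof.
by rewrite /real_scalar; case: k; split=> // x y; rewrite rmorphM.
Qed.
HB.instance Definition _ :=
  GRing.isMonoidMorphism.Build R K real_scalar real_scalar_monoid_morphism.

Fact sconj_zmod_morphism : zmod_morphism (@sconj R k).
Proof. by rewrite /sconj; case: k => // x y; rewrite rmorphB. Qed.
Fact sconj_monoid_morphism : monoid_morphism (@sconj R k).
Proof.
by rewrite /sconj; case: k; split=> [|x y] //; rewrite ?rmorph1 ?rmorphM.
Qed.
HB.instance Definition _ :=
  GRing.isZmodMorphism.Build K K (@sconj R k) sconj_zmod_morphism.
HB.instance Definition _ :=
  GRing.isMonoidMorphism.Build K K (@sconj R k) sconj_monoid_morphism.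

Fact sre_zmod_morphism : zmod_morphism (@sre R k).
Proof. by rewrite /sre; case: k => // [[a b] [c e]]. Qed.
HB.instance Definition _ :=
  GRing.isZmodMorphism.Build K R (@sre R k) sre_zmod_morphism.

Lemma sconjK : involutive (@sconj R k).
Proof. by rewrite /sconj; case: k => // x; rewrite conjCK. Qed.

Lemma sre_sconj x : sre (sconj x) = sre x.
Proof. by move: x; rewrite /sconj /sre; case: k => // [[a b]]. Qed.

Lemma real_scalarK : cancel real_scalar (@sre R k).
Proof. by rewrite /real_scalar /sre; case: k. Qed.

Lemma sre_real_scalarM r x : sre (real_scalar r * x) = r * sre x.
Proof.
move: x; rewrite /real_scalar /sre; case: k => // [[a b]] /=.
by rewrite mul0r subr0.
Qed.

Lemma ler_real_scalar r s : (real_scalar r <= real_scalar s) = (r <= s).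
Proof. by rewrite /real_scalar; case: k => //; rewrite lecR. Qed.

Lemma sre_normX2 x : sre `|x| ^+ 2 = sre (sconj x * x).
Proof.
move: x; rewrite /sconj /sre; case: k => x.
  by rewrite real_normK ?num_real.
rewrite mulrC -normCK expr2 -[x]/x.
by case: (`|x|) (ger0_Im (normr_ge0 x)) => a b /= ->; rewrite mulr0 subr0.
Qed.

Lemma sre_le x y : x <= y -> sre x <= sre y.
Proof.
by move: x y; rewrite /sre; case: k => // x y; rewrite lecE => /andP[].
Qed.

Lemma ge0_real_scalar x : 0 <= x -> x = real_scalar (sre x).
Proof.
move: x; rewrite /sre /real_scalar; case: k => // x x0.
by rewrite RRe_real // ger0_real.
Qed.

End Scalars.

(** * The real inner product of column vectors *)

Section InnerProduct.
Context {R : realType} {k : scalar_kind}.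
Local Notation K := (scalars R k).

Lemma adjmxK p q (A : 'M[K]_(p, q)) : adjmx (adjmx A) = A.
Proof. by apply/matrixP=> i j; rewrite !mxE sconjK. Qed.

Lemma adjmxM p q r (A : 'M[K]_(p, q)) (B : 'M[K]_(q, r)) :
  adjmx (A *m B) = adjmx B *m adjmx A.
Proof. by rewrite /adjmx map_mxM trmx_mul. Qed.

Lemma adjmx1 p : adjmx (1%:M : 'M[K]_p) = 1%:M.
Proof. by rewrite /adjmx map_mx1 trmx1. Qed.

(** The real part of the usual inner product: it is symmetric and real bilinear
    for both kinds of scalars, so that the estimates below are identities and
    inequalities between real numbers. *)
Definition inner p (u v : 'cV[K]_p) : R := sre ((adjmx u *m v) 0 0).

Lemma innerC p (u v : 'cV[K]_p) : inner u v = inner v u.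
Proof.
rewrite /inner -[RHS]sre_sconj; congr sre.
by rewrite -[u in RHS]adjmxK -adjmxM !mxE sconjK.
Qed.

Lemma innerDr p (u v w : 'cV[K]_p) : inner u (v + w) = inner u v + inner u w.
Proof. by rewrite /inner mulmxDr mxE raddfD. Qed.

Lemma innerNr p (u v : 'cV[K]_p) : inner u (- v) = - inner u v.
Proof. by rewrite /inner mulmxN mxE raddfN. Qed.

Lemma innerZr p a (u v : 'cV[K]_p) :
  inner u (real_scalar a *: v) = a * inner u v.
Proof. by rewrite /inner -scalemxAr mxE sre_real_scalarM. Qed.

Lemma inner_adj p q (A : 'M[K]_(p, q)) u v :
  inner (A *m u) v = inner u (adjmx A *m v).
Proof. by rewrite /inner adjmxM mulmxA. Qed.

Lemma sqnorm_inner p (v : 'cV[K]_p) : sqnorm v = inner v v.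
Proof.
rewrite /sqnorm /inner mxE raddf_sum; apply: eq_bigr => i _.
by rewrite !mxE sre_normX2.
Qed.

Lemma sqnorm_ge0 p (v : 'cV[K]_p) : 0 <= sqnorm v.
Proof. by apply: sumr_ge0 => i _; rewrite sqr_ge0. Qed.

Lemma sqnormD p (u v : 'cV[K]_p) :
  sqnorm (u + v) = sqnorm u + 2 * inner u v + sqnorm v.
Proof.
rewrite !sqnorm_inner innerDr [inner _ u]innerC [inner _ v]innerC !innerDr.
by rewrite (innerC v u); ring.
Qed.

Lemma sqnormN p (u : 'cV[K]_p) : sqnorm (- u) = sqnorm u.
Proof. by rewrite !sqnorm_inner innerNr innerC innerNr opprK. Qed.

(** Young's form of Cauchy-Schwarz, which avoids square roots: it is the
    nonnegativity of [|c u - v|^2] divided by [c]. *)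
Lemma inner_young p c (u v : 'cV[K]_p) : 0 < c ->
  2 * inner u v <= c * sqnorm u + c^-1 * sqnorm v.
Proof.
move=> c0; have := sqnorm_ge0 (real_scalar c *: u - v).
rewrite sqnormD sqnormN innerNr innerC innerZr sqnorm_inner innerZr innerC.
rewrite innerZr -sqnorm_inner (innerC v) => h.
have ci : 0 < c^-1 by rewrite invr_gt0.
have := mulr_ge0 (ltW ci) h.
have -> : c^-1 * (c * (c * sqnorm u) + 2 * - (c * inner u v) + sqnorm v) =
  c * sqnorm u - 2 * inner u v + c^-1 * sqnorm v by field; rewrite gt_eqF.
lra.
Qed.

Lemma sqnorm_eq0 p (v : 'cV[K]_p) : (sqnorm v == 0) = (v == 0).
Proof.
apply/eqP/eqP => [/psumr_eq0P|->]; last first.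
  by rewrite /sqnorm big1 // => i _; rewrite mxE normr0 raddf0 expr0n.
move=> h; apply/matrixP => i j; rewrite ord1 mxE; apply/eqP.
rewrite -normr_eq0 (ge0_real_scalar (normr_ge0 _)).
have /eqP := h (fun i _ => sqr_ge0 _) i isT.
by rewrite sqrf_eq0 => /eqP ->; rewrite raddf0.
Qed.

Lemma sqnorm_const1_gt0 p : (0 < p)%N -> 0 < sqnorm (const_mx 1 : 'cV[K]_p).
Proof.
move=> p0; rewrite lt0r sqnorm_ge0 sqnorm_eq0 andbT.
apply/eqP => /matrixP/(_ (Ordinal p0) 0).
by rewrite !mxE; apply/eqP; rewrite oner_eq0.
Qed.

End InnerProduct.

(** * The spectral theorem *)

Lemma char_poly_conj (F : fieldType) p (U D : 'M[F]_p) : U \in unitmx ->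
  char_poly (invmx U *m D *m U) = char_poly D.
Proof.
move=> Uu; have UV : map_mx polyC (invmx U) *m map_mx polyC U = 1%:M.
  by rewrite -map_mxM mulVmx // map_mx1.
rewrite /char_poly.
suff -> : char_poly_mx (invmx U *m D *m U) =
    map_mx polyC (invmx U) *m char_poly_mx D *m map_mx polyC U.
  by rewrite !det_mulmx mulrAC -det_mulmx UV det1 mul1r.
rewrite /char_poly_mx mulmxBr mulmxBl mul_mx_scalar -scalemxAl UV.
by rewrite scalemx1 !map_mxM.
Qed.

Section Spectrum.
Context {R : realType}.

(** The weights are the squared moduli of the coordinates of [v] in an
    orthonormal basis of eigenvectors. *)
Lemma complex_hermitian_spectrum p (M : 'M[R[i]]_p) :
  adjmx (k := ComplexScalars) M = M -> exists r : 'I_p -> R,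
  char_poly M = \prod_i ('X - ((r i)%:C)%C%:P) /\
  forall v : 'cV[R[i]]_p, exists w : 'I_p -> R,
  [/\ forall i, 0 <= w i,
      sqnorm (k := ComplexScalars) v = \sum_i w i
    & inner (k := ComplexScalars) v (M *m v) = \sum_i r i * w i].
Proof.
move=> hM.
have hermM : M \is hermsymmx.
  apply/is_hermitianmxP; rewrite expr0 scale1r -[LHS]hM.
  by rewrite /adjmx map_trmx.
have Mr := hermitian_spectral_diag_real hermM.
have /orthomx_spectralP ME := hermitian_normalmx hermM.
have Uu := spectral_unitarymx M.
set U := spectralmx M in ME Uu; set D := spectral_diag M in Mr ME.
have Uunit := spectral_unit M.
pose r i := complex.Re (D 0 i).
have rE i : ((r i)%:C)%C = D 0 i by rewrite RRe_real //; apply: (mxOverP Mr).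
have aU : adjmx (k := ComplexScalars) U = invmx U.
  by rewrite invmx_unitary // /adjmx map_trmx.
exists r; split.
  rewrite ME char_poly_conj //.
  rewrite char_poly_trig ?diag_mx_is_trig //.
  by apply: eq_bigr => i _; rewrite rE mxE eqxx mulr1n.
move=> v; exists (fun i => complex.Re `|(U *m v) i 0| ^+ 2); split.
- by move=> i; rewrite sqr_ge0.
- rewrite -/(sqnorm (k:=ComplexScalars) (U *m v)).
  by rewrite !sqnorm_inner inner_adj mulmxA [X in X *m U]aU mulVmx // mul1mx.
- rewrite {1}ME -!mulmxA -aU -(adjmxK (k:=ComplexScalars) U) -inner_adj.
  rewrite (adjmxK (k:=ComplexScalars) U).
  rewrite /inner mxE raddf_sum; apply: eq_bigr => i _.
  rewrite mul_diag_mx !mxE -rE.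
  rewrite -[LHS]/(sre (k := ComplexScalars) _).
  rewrite mulrCA (@sre_real_scalarM _ ComplexScalars).
  by rewrite -(@sre_normX2 _ ComplexScalars).
Qed.

Lemma sqnorm_complexify p (v : 'cV[R]_p) :
  sqnorm (k := ComplexScalars) (map_mx (real_complex R) v) =
  sqnorm (k := RealScalars) v.
Proof.
apply: eq_bigr => i _; rewrite mxE /sre.
by rewrite (normc_def (v i 0)%:C%C) /= expr0n /= addr0 sqrtr_sqr.
Qed.

(** Over the reals, complexify: the factorization of the characteristic
    polynomial descends because its roots are real, and the weights of a real
    vector are those of its complexification. *)
Theorem hermitian_spectrum k p (M : 'M[scalars R k]_p) : adjmx M = M ->
  exists r : 'I_p -> R,
  char_poly M = \prod_i ('X - (real_scalar (r i))%:P) /\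
  forall v : 'cV[scalars R k]_p, exists w : 'I_p -> R,
  [/\ forall i, 0 <= w i, sqnorm v = \sum_i w i
    & inner v (M *m v) = \sum_i r i * w i].
Proof.
case: k M => M hM; last exact: complex_hermitian_spectrum.
have hMC : adjmx (k := ComplexScalars) (map_mx (real_complex R) M) =
    map_mx (real_complex R) M.
  apply/matrixP => i j; rewrite !mxE -[in RHS]hM !mxE /=.
  exact: conjc_real.
have [r [charE wP]] := complex_hermitian_spectrum hMC.
exists r; split.
  apply: (map_poly_inj (real_complex R)).
  rewrite map_char_poly charE rmorph_prod.
  by apply: eq_bigr => i _; rewrite rmorphB /= map_polyX map_polyC.
move=> v; have [w [w0 wn wi]] := wP (map_mx (real_complex R) v).
exists w; split => //; first by rewrite -wn sqnorm_complexify.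
rewrite -wi -map_mxM /inner !mxE !raddf_sum; apply: eq_bigr => i _.
have h (a c : R) : a * c = complex.Re (conjc (a%:C)%C * (c%:C)%C).
  by rewrite conjc_real -rmorphM.
rewrite !mxE; exact: h.
Qed.

End Spectrum.

(** * Quadratic forms, extreme eigenvalues and singular values *)

Section EigenvalueBounds.
Context {R : realType} {k : scalar_kind}.
Local Notation K := (scalars R k).

Lemma eigenvalue_char_poly_prod p (M : 'M[K]_p) (r : 'I_p -> R) :
  char_poly M = \prod_i ('X - (real_scalar (r i))%:P) ->
  forall mu, eigenvalue M mu <-> exists i, mu = real_scalar (r i).
Proof.
move=> cM mu; rewrite eigenvalue_root_char cM.
rewrite -(big_map (fun i => real_scalar (r i)) xpredT (fun x => 'X - x%:P)).
rewrite root_prod_XsubC; split=> [/mapP[i _ ->]|[i ->]]; first by exists i.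
by apply/mapP; exists i => //; rewrite mem_index_enum.
Qed.

(** [eigenvalue] is about row vectors [v] with [v M = l v]; as [M] is Hermitian,
    the adjoint of [v] is the column eigenvector wanted here. *)
Lemma eigenvalue_rayleigh p (M : 'M[K]_p) l : adjmx M = M ->
  eigenvalue M (real_scalar l) ->
  exists2 u : 'cV[K]_p, u != 0 & inner u (M *m u) = l * sqnorm u.
Proof.
move=> hM /eigenvalueP[v vM v0]; exists (adjmx v).
  by apply: contraNneq v0 => h; rewrite -(adjmxK v) h /adjmx map_mx0 trmx0.
rewrite -[X in _ = l * X]/(sqnorm (adjmx v)) innerC inner_adj hM.
rewrite -[M in LHS]hM -adjmxM vM sqnorm_inner -innerZr; congr inner.
apply/matrixP => i j; rewrite !mxE rmorphM; congr (_ * _).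
by rewrite /sconj /real_scalar; case: k => //; exact: conjc_real.
Qed.

(** Every weight in [hermitian_spectrum] multiplies an eigenvalue that is at most
    [lambda_max M].  The index [i0] of a largest eigenvalue shows that the set
    from which [lambda_max] picks is inhabited. *)
Lemma inner_le_lambda_max p (M : 'M[K]_p) (v : 'cV[K]_p) : adjmx M = M ->
  inner v (M *m v) <= lambda_max M * sqnorm v.
Proof.
move=> /hermitian_spectrum[r [/eigenvalue_char_poly_prod eigP wP]].
have [w [w0 -> ->]] := wP v; rewrite mulr_sumr.
apply: ler_sum => i _; apply: ler_wpM2r => //.
pose i0 := [arg max_(j > i) r j]%O.
rewrite /lambda_max; case: xgetP => [l _ [_ lmax]|/(_ (real_scalar (r i0)))[]].
  rewrite -[r i](@real_scalarK _ k); apply: sre_le.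
  by apply: lmax; apply/eigP; exists i.
split; first by apply/eigP; exists i0.
move=> mu /eigP[j ->]; rewrite ler_real_scalar /i0.
by case: arg_maxP => // i1 _; exact.
Qed.

Lemma lambda_min_le_inner p (M : 'M[K]_p) (v : 'cV[K]_p) : adjmx M = M ->
  lambda_min M * sqnorm v <= inner v (M *m v).
Proof.
move=> /hermitian_spectrum[r [/eigenvalue_char_poly_prod eigP wP]].
have [w [w0 -> ->]] := wP v; rewrite mulr_sumr.
apply: ler_sum => i _; apply: ler_wpM2r => //.
pose i0 := [arg min_(j < i) r j]%O.
rewrite /lambda_min; case: xgetP => [l _ [_ lmin]|/(_ (real_scalar (r i0)))[]].
  rewrite -[r i](@real_scalarK _ k); apply: sre_le.
  by apply: lmin; apply/eigP; exists i.
split; first by apply/eigP; exists i0.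
move=> mu /eigP[j ->]; rewrite ler_real_scalar /i0.
by case: arg_minP => // i1 _; exact.
Qed.

Lemma inner_gram p q (A : 'M[K]_(p, q)) (v : 'cV[K]_q) :
  inner v (adjmx A *m A *m v) = sqnorm (A *m v).
Proof. by rewrite sqnorm_inner inner_adj mulmxA. Qed.

Lemma adjmx_gram p q (A : 'M[K]_(p, q)) :
  adjmx (adjmx A *m A) = adjmx A *m A.
Proof. by rewrite adjmxM adjmxK. Qed.

Lemma full_col_rank_mulmx_eq0 p q (A : 'M[K]_(p, q)) (v : 'cV[K]_q) :
  \rank A = q -> A *m v = 0 -> v = 0.
Proof.
move=> rA /(congr1 trmx); rewrite trmx_mul trmx0 => h.
have fA : row_free A^T by rewrite /row_free mxrank_tr rA.
by apply: trmx_inj; rewrite trmx0; apply: (row_free_inj fA); rewrite mul0mx.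
Qed.

(** Singular values exist because a Gram matrix has a nonnegative spectrum: at an
    eigenvector [u], the Rayleigh quotient is [|A u|^2 / |u|^2]. *)
Lemma singular_valuesP p q (A : 'M[K]_(p, q)) :
  is_singular_values A (singular_values A).
Proof.
have [r [cA _]] := hermitian_spectrum (adjmx_gram A).
have eigP := eigenvalue_char_poly_prod cA.
have r0 i : 0 <= r i.
  have ei : eigenvalue (adjmx A *m A) (real_scalar (r i)).
    by apply/eigP; exists i.
  have [u u0] := eigenvalue_rayleigh (adjmx_gram A) ei.
  rewrite inner_gram => h; have := sqnorm_ge0 (A *m u).
  by rewrite h pmulr_lge0 // lt0r sqnorm_eq0 u0 sqnorm_ge0.
pose s := sort (fun x y : R => y <= x) [seq Num.sqrt (r i) | i : 'I_q].
rewrite /singular_values; apply: (@xgetI _ _ _ [seq real_scalar x | x <- s]).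
split.
- rewrite sorted_map (@eq_sorted _ _ (fun x y : R => y <= x)) /s.
    by apply: sort_sorted => x y; exact: le_total.
  by move=> x y /=; rewrite ler_real_scalar.
- rewrite all_map; apply/allP => x /=; rewrite mem_sort => /mapP[i _ ->].
  by rewrite -[0](raddf0 (@real_scalar R k)) ler_real_scalar sqrtr_ge0.
- rewrite cA big_map (perm_big [seq Num.sqrt (r i) | i : 'I_q]); last first.
    by rewrite /s perm_sort.
  rewrite big_map big_enum; apply: eq_bigr => i _.
  by rewrite -(rmorphXn (@real_scalar R k)) sqr_sqrtr.
Qed.

Lemma size_singular_values p q (A : 'M[K]_(p, q)) : size (singular_values A) = q.
Proof.
have [_ _ cA] := singular_valuesP A.
have := size_char_poly (adjmx A *m A); rewrite cA.
rewrite -(big_map (fun x => x ^+ 2) xpredT (fun x => 'X - x%:P)).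
by rewrite size_prod_XsubC size_map => -[].
Qed.

Lemma eigenvalue_gramP p q (A : 'M[K]_(p, q)) mu :
  reflect (exists2 x, x \in singular_values A & mu = x ^+ 2)
    (eigenvalue (adjmx A *m A) mu).
Proof.
have [_ _ cA] := singular_valuesP A; rewrite eigenvalue_root_char cA.
rewrite -(big_map (fun x => x ^+ 2) xpredT (fun x => 'X - x%:P)).
by rewrite root_prod_XsubC; exact: mapP.
Qed.

Lemma singular_value_real p q (A : 'M[K]_(p, q)) x : x \in singular_values A ->
  0 <= sre x /\ x = real_scalar (sre x).
Proof.
have [_ /allP s0 _] := singular_valuesP A; move=> /s0 x0.
by split; [rewrite -(raddf0 (@sre R k)) sre_le | exact: ge0_real_scalar].
Qed.

Lemma sigma_min_ge0 p q (A : 'M[K]_(p, q)) : 0 <= sigma_min A.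
Proof.
rewrite /sigma_min; have [h|h] := ltnP (minn p q).-1 (size (singular_values A)).
  by have [] := singular_value_real (mem_nth 0 h).
by rewrite nth_default // raddf0.
Qed.

Lemma sigma_min_eigenvalue p q (A : 'M[K]_(p, q)) : (0 < q <= p)%N ->
  eigenvalue (adjmx A *m A) (real_scalar (sigma_min A ^+ 2)).
Proof.
move=> /andP[q0 qp]; apply/eigenvalue_gramP.
have h : nth 0 (singular_values A) (minn p q).-1 \in singular_values A.
  by rewrite mem_nth // size_singular_values (minn_idPr qp) prednK.
exists (nth 0 (singular_values A) (minn p q).-1) => //.
by rewrite rmorphXn; congr (_ ^+ 2); case: (singular_value_real h).
Qed.

(** As [q <= p], the index [minn p q] in [sigma_min] designates the last of the [q]
    singular values, the smallest one. *)
Lemma sigma_min_le_eigenvalue p q (A : 'M[K]_(p, q)) l : (q <= p)%N ->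
  eigenvalue (adjmx A *m A) (real_scalar l) -> sigma_min A ^+ 2 <= l.
Proof.
move=> qp /eigenvalue_gramP[x xs lx].
have [x0 xE] := singular_value_real xs.
have -> : l = sre x ^+ 2.
  rewrite -[l](@real_scalarK _ k) lx xE -(rmorphXn (@real_scalar R k)).
  by rewrite !real_scalarK.
rewrite lerXn2r ?nnegrE ?sigma_min_ge0 // /sigma_min (minn_idPr qp).
apply: sre_le; rewrite -(nth_index 0 xs).
have [sorted_s _ _] := singular_valuesP A.
have h : (index x (singular_values A) < q)%N.
  by rewrite -{2}(size_singular_values A) index_mem.
have q0 := leq_ltn_trans (leq0n _) h.
apply: (sorted_leq_nth _ _ 0 sorted_s) => //.
- by move=> a b c ab bc; exact: le_trans bc ab.
- by rewrite inE index_mem.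
- by rewrite inE size_singular_values prednK.
- by rewrite -ltnS prednK.
Qed.

Lemma sigma_min_mulmx p q (A : 'M[K]_(p, q)) (v : 'cV[K]_q) : (q <= p)%N ->
  sigma_min A ^+ 2 * sqnorm v <= sqnorm (A *m v).
Proof.
move=> qp; rewrite -inner_gram.
have [r [/eigenvalue_char_poly_prod eigP wP]] :=
  hermitian_spectrum (adjmx_gram A).
have [w [w0 -> ->]] := wP v; rewrite mulr_sumr.
apply: ler_sum => i _; apply: ler_wpM2r => //.
by apply: sigma_min_le_eigenvalue qp _; apply/eigP; exists i.
Qed.

Lemma sigma_min_gt0 p q (A : 'M[K]_(p, q)) : (0 < q)%N -> \rank A = q ->
  0 < sigma_min A ^+ 2.
Proof.
move=> q0 rA; have qp : (0 < q <= p)%N by rewrite q0 -rA rank_leq_row.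
have [u u0] := eigenvalue_rayleigh (adjmx_gram A) (sigma_min_eigenvalue A qp).
rewrite inner_gram => h; rewrite lt0r sqr_ge0 andbT.
apply: contra_neq u0 => s0; apply: (full_col_rank_mulmx_eq0 rA).
by apply/eqP; rewrite -sqnorm_eq0 h s0 mul0r.
Qed.

End EigenvalueBounds.

(** * One projection step on a block of full row rank *)

Section Projection.
Context {R : realType} {k : scalar_kind}.
Local Notation K := (scalars R k).

Lemma hermitian_unitmx p (G : 'M[K]_p) alpha : adjmx G = G -> 0 < alpha ->
  alpha <= lambda_min G -> G \in unitmx.
Proof.
move=> hG alpha0 alphaG; rewrite -row_free_unit; apply: inj_row_free => v vG.
suff : adjmx v == 0 by move/eqP=> h; rewrite -(adjmxK v) h /adjmx map_mx0 trmx0.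
have Gv : G *m adjmx v = 0.
  by rewrite -[X in X *m _]hG -adjmxM vG /adjmx map_mx0 trmx0.
have := lambda_min_le_inner (adjmx v) hG.
rewrite Gv /inner mulmx0 mxE raddf0 pmulr_rle0 ?(lt_le_trans alpha0) // => h.
by rewrite -sqnorm_eq0 eq_le h sqnorm_ge0.
Qed.

Section Block.
Context {p q : nat} (A : 'M[K]_(p, q)).
Let G := A *m adjmx A.

Lemma adjmx_row_gram : adjmx G = G.
Proof. by rewrite /G adjmxM adjmxK. Qed.

Lemma inner_row_gram v : inner v (G *m v) = sqnorm (adjmx A *m v).
Proof. by rewrite sqnorm_inner inner_adj adjmxK mulmxA. Qed.

(** The bound on [A A^*] controls [A^*]; it passes to [A] by duality: with
    [y = A u], [|y|^2 = <u, A^* y>], and Young's inequality absorbs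
    [|A^* y|^2 / beta <= |y|^2]. *)
Lemma sqnorm_mulmx_le beta u : 0 < beta -> lambda_max G <= beta ->
  sqnorm (A *m u) <= beta * sqnorm u.
Proof.
move=> beta0 Gbeta; set y := A *m u.
have h1 : inner u (adjmx A *m y) = sqnorm y by rewrite -inner_adj sqnorm_inner.
have h2 : sqnorm (adjmx A *m y) <= beta * sqnorm y.
  rewrite -inner_row_gram (le_trans (inner_le_lambda_max _ adjmx_row_gram)) //.
  by rewrite ler_wpM2r // sqnorm_ge0.
have := inner_young u (adjmx A *m y) beta0; rewrite h1.
have : beta^-1 * sqnorm (adjmx A *m y) <= sqnorm y by rewrite ler_pdivrMl.
lra.
Qed.

Context {alpha : R} (alpha0 : 0 < alpha) (alphaG : alpha <= lambda_min G).
Local Notation B := (moore_penrose A).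

(** The set from which [moore_penrose] picks is inhabited: for full row rank,
    [A^* (A A^* )^-1] is a pseudoinverse. *)
Lemma moore_penroseP : is_moore_penrose A B.
Proof.
have Gu : G \in unitmx := hermitian_unitmx adjmx_row_gram alpha0 alphaG.
apply: (@xgetI _ _ _ (adjmx A *m invmx G)).
have AB : A *m (adjmx A *m invmx G) = 1%:M by rewrite mulmxA mulmxV.
have Gi : adjmx (invmx G) = invmx G.
  have := mulmxV Gu => /(congr1 (fun X => adjmx X)).
  rewrite adjmxM adjmx_row_gram adjmx1.
  by move=> /(congr1 (fun X => X *m invmx G)); rewrite mulmxK // mul1mx.
split; rewrite ?AB ?mul1mx ?adjmx1 //.
- by rewrite -!mulmxA AB mulmx1.
- by rewrite !adjmxM adjmxK Gi mulmxA.
Qed.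

Lemma mulmx_moore_penrose : A *m B = 1%:M.
Proof.
have [ABA _ _ _] := moore_penroseP.
have Gu : G \in unitmx := hermitian_unitmx adjmx_row_gram alpha0 alphaG.
have := congr1 (fun X => X *m adjmx A *m invmx G) ABA.
by rewrite /= -[A *m B *m A *m _]mulmxA mulmxK // mulmxV.
Qed.

(** The vector [y = B e] lies in the row space, [y = A^* z] with [z = B^* y], so
    that [alpha |z|^2 <= |y|^2], while [|y|^2 = <e, z>] because [A B = 1]. *)
Lemma sqnorm_moore_penrose_le e : sqnorm (B *m e) <= alpha^-1 * sqnorm e.
Proof.
have [_ BAB _ hBA] := moore_penroseP.
set y := B *m e; set z := adjmx B *m y.
have yz : adjmx A *m z = y by rewrite /z mulmxA -adjmxM hBA /y mulmxA BAB.
have h1 : sqnorm y = inner e z.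
  rewrite sqnorm_inner -{2}yz -inner_adj /y mulmxA.
  by rewrite mulmx_moore_penrose mul1mx.
have h2 : alpha * sqnorm z <= sqnorm y.
  rewrite -yz -inner_row_gram.
  apply: le_trans (lambda_min_le_inner _ adjmx_row_gram).
  by rewrite ler_wpM2r // sqnorm_ge0.
have ai : 0 < alpha^-1 by rewrite invr_gt0.
have := inner_young e z ai; rewrite invrK -h1; lra.
Qed.

(** Pythagoras, used twice: [B A] is an orthogonal projection, and it fixes
    [B e]. *)
Lemma sqnorm_block_step u e :
  sqnorm (u - B *m (A *m u + e)) =
  sqnorm u - sqnorm (B *m (A *m u)) + sqnorm (B *m e).
Proof.
have [_ BAB _ hBA] := moore_penroseP.
set y := B *m e; set x := B *m (A *m u).
have PB v : B *m (A *m (B *m v)) = B *m v by rewrite !mulmxA BAB.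
have iP v w : inner v (B *m w) = inner (B *m (A *m v)) (B *m w).
  by rewrite [in RHS]mulmxA inner_adj hBA -mulmxA PB.
have h1 : inner u x = sqnorm x by rewrite iP sqnorm_inner.
have h2 : inner u y = inner x y by rewrite iP.
rewrite mulmxDr opprD addrA -/x -/y.
rewrite !sqnormD !sqnormN !innerNr h1 (innerC (u - x)) innerDr innerNr.
by rewrite (innerC y u) (innerC y x) h2; ring.
Qed.

End Block.

End Projection.

(** * One random step of the block Kaczmarz iteration *)

Section Kaczmarz.
Context {R : realType} {k : scalar_kind}.
Local Notation K := (scalars R k).
Context {n d : nat} (A : 'M[K]_(n, d)).

Definition kaczmarz_step (b : 'cV[K]_n) (t : {set 'I_n}) (x : 'cV[K]_d) :=
  x + moore_penrose (row_block A t) *m (row_block b t - row_block A t *m x).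

Lemma row_block_mulmx (t : {set 'I_n}) (x : 'cV[K]_d) :
  row_block A t *m x = row_block (A *m x) t.
Proof. exact: mul_rowsub_mx. Qed.

Lemma sum_sqnorm_row_block (T : {set {set 'I_n}}) (v : 'cV[K]_n) :
  finset.partition T [set: 'I_n]%SET ->
  \sum_(t in T) sqnorm (row_block v t) = sqnorm v.
Proof.
move=> pT; rewrite /sqnorm [RHS](eq_bigl (fun i => i \in [set: _]%SET)) => [|i];
  last by rewrite finset.inE.
rewrite (set_partition_big _ pT).
apply: eq_bigr => t _; rewrite [RHS]big_enum_val.
by apply: eq_bigr => i _; rewrite mxE.
Qed.

Lemma kaczmarz_step_error b t x xstar :
  kaczmarz_step b t x - xstar = (x - xstar) -
    moore_penrose (row_block A t) *m
      (row_block A t *m (x - xstar) + row_block (A *m xstar - b) t).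
Proof.
rewrite /kaczmarz_step addrAC; congr (_ + _).
rewrite -[RHS]mulmxN; congr (_ *m _).
rewrite mulmxBr !row_block_mulmx; apply/matrixP => i j; rewrite !mxE; ring.
Qed.

(** The projected part of the error is bounded below by
    [|At u|^2 = |At (At^+ At u)|^2 <= beta |At^+ At u|^2]. *)
Lemma kaczmarz_step_le b t x xstar alpha beta : 0 < alpha -> 0 < beta ->
  let G := row_block A t *m adjmx (row_block A t) in
  alpha <= lambda_min G -> lambda_max G <= beta ->
  sqnorm (kaczmarz_step b t x - xstar) <= sqnorm (x - xstar) -
    beta^-1 * sqnorm (row_block (A *m (x - xstar)) t) +
    alpha^-1 * sqnorm (row_block (A *m xstar - b) t).
Proof.
move=> alpha0 beta0 G alphaG Gbeta; rewrite kaczmarz_step_error.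
rewrite (sqnorm_block_step alpha0 alphaG).
rewrite lerD ?(sqnorm_moore_penrose_le alpha0) //.
rewrite lerB // ler_pdivrMl //.
apply: le_trans _ (sqnorm_mulmx_le _ beta0 Gbeta).
by rewrite mulmxA (mulmx_moore_penrose alpha0) // mul1mx row_block_mulmx.
Qed.

Context {T : {set {set 'I_n}}} {m : nat} {alpha beta : R}.
Context (hrank : \rank A = d) (alpha0 : 0 < alpha) (d0 : (0 < d)%N)
  (paving : row_paving A m alpha beta T).

(** As [d > 0] and [A] has rank [d], there is a row, hence a nonempty block [t];
    for it [alpha |v|^2 <= <v, At At^* v> <= beta |v|^2] at a nonzero [v]. *)
Lemma paving_gt0 : (0 < m)%N /\ 0 < beta.
Proof.
have [pT cT sT] := paving; have /and3P[/eqP covT _ T0] := pT.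
have n0 : (0 < n)%N by rewrite (leq_trans d0) // -hrank rank_leq_row.
have /finset.bigcupP[t tT _] : Ordinal n0 \in finset.cover T.
  by rewrite covT finset.inE.
split; first by rewrite -cT card_gt0; apply/set0Pn; exists t.
have t0 : (0 < #|t|)%N by rewrite card_gt0; apply: contraNneq T0 => <-.
have [aG Gb] := sT t tT.
pose v : 'cV[K]_#|t| := const_mx 1.
have v0 : 0 < sqnorm v by exact: sqnorm_const1_gt0.
have h := le_trans (lambda_min_le_inner v (adjmx_row_gram (row_block A t)))
  (inner_le_lambda_max v (adjmx_row_gram (row_block A t))).
rewrite (lt_le_trans alpha0) // (le_trans aG) // (le_trans _ Gb) //.
by rewrite -(ler_pM2r v0).
Qed.

Lemma kaczmarz_step_average b x xstar :
  m%:R^-1 * (\sum_(t in T) sqnorm (kaczmarz_step b t x - xstar)) <=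
  (1 - sigma_min A ^+ 2 / (beta * m%:R)) * sqnorm (x - xstar)
  + sqnorm (A *m xstar - b) / (alpha * m%:R).
Proof.
have [m0 beta0] := paving_gt0; have [pT cT sT] := paving.
have m0' : 0 < m%:R :> R by rewrite ltr0n.
have h : \sum_(t in T) sqnorm (kaczmarz_step b t x - xstar) <=
    m%:R * sqnorm (x - xstar) - beta^-1 * sqnorm (A *m (x - xstar))
    + alpha^-1 * sqnorm (A *m xstar - b).
  rewrite -2!(sum_sqnorm_row_block _ pT) -cT mulr_natl -sumr_const.
  rewrite !mulr_sumr -sumrB -big_split; apply: ler_sum => t tT.
  by have [aG Gb] := sT t tT; apply: kaczmarz_step_le.
rewrite ler_pdivrMl // (le_trans h) //.
have := sigma_min_mulmx A (x - xstar).
rewrite -{1}hrank rank_leq_row => /(_ isT) hs.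
have -> : m%:R * ((1 - sigma_min A ^+ 2 / (beta * m%:R)) * sqnorm (x - xstar)
    + sqnorm (A *m xstar - b) / (alpha * m%:R)) =
  m%:R * sqnorm (x - xstar) - beta^-1 * (sigma_min A ^+ 2 * sqnorm (x - xstar))
    + alpha^-1 * sqnorm (A *m xstar - b).
  by field; rewrite ?gt_eqF.
by rewrite lerD2r lerB // ler_pM2l ?invr_gt0.
Qed.

(** For a nonzero [v], [sigma_min^2 |v|^2 <= |A v|^2], and [|A v|^2] is the sum
    over the [m] blocks of [|At v|^2], each at most [beta |v|^2]. *)
Lemma contraction_factor_ge0 : 0 <= 1 - sigma_min A ^+ 2 / (beta * m%:R).
Proof.
have [m0 beta0] := paving_gt0; have [pT cT sT] := paving.
have m0' : 0 < m%:R :> R by rewrite ltr0n.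
pose v : 'cV[K]_d := const_mx 1.
have v0 : 0 < sqnorm v by exact: sqnorm_const1_gt0.
rewrite subr_ge0 ler_pdivrMr ?mulr_gt0 // mul1r -(ler_pM2r v0).
have := sigma_min_mulmx A v; rewrite -{1}hrank rank_leq_row => /(_ isT) hs.
rewrite (le_trans hs) // -(sum_sqnorm_row_block _ pT) -mulrA mulrCA.
rewrite -cT mulr_natl -sumr_const.
apply: ler_sum => t tT; rewrite -row_block_mulmx.
by have [_ Gb] := sT t tT; apply: sqnorm_mulmx_le.
Qed.

End Kaczmarz.

(** * Expectations of functions of the past blocks *)

Section FiniteValuedExpectation.
Context {R : realType} {disp : measure_display} {Omega : measurableType disp}
  (P : probability Omega R).

Lemma expectation_finite_valued (F : finType) (Y : Omega -> F) (g : F -> R) :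
  (forall y, measurable [set w | Y w = y]%classic) -> (forall y, 0 <= g y) ->
  ('E_P[fun w => g (Y w)] =
   (\sum_y g y * fine (P [set w | Y w = y]%classic))%:E)%E.
Proof.
move=> mY g0; rewrite unlock.
have gE w : (g (Y w))%:E =
    (\sum_(y : F) (g y)%:E * (\1_[set w | Y w = y]%classic w)%:E)%E.
  rewrite (bigD1 (Y w)) //= indicE mem_set // mule1 big1 ?adde0 // => y yY.
  rewrite indicE memNset ?mule0 //= => h; by rewrite h eqxx in yY.
under eq_integral do rewrite gE.
rewrite ge0_integral_sum //=; last 2 first.
- move=> y; apply: emeasurable_funM => //.
  by apply/measurable_EFinP; exact: measurable_indic.
- by move=> y w _; rewrite -EFinM lee_fin mulr_ge0.
rewrite -sumEFin; apply: eq_bigr => y _.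
rewrite ge0_integralZl ?lee_fin //.
- rewrite integral_indic // setIT EFinM fineK // fin_num_measure //.
- by apply/measurable_EFinP; exact: measurable_indic.
Qed.

Lemma sum_finite_valued_probability (F : finType) (Y : Omega -> F) :
  (forall y, measurable [set w | Y w = y]%classic) ->
  \sum_y fine (P [set w | Y w = y]%classic) = 1.
Proof.
move=> mY; have := expectation_finite_valued mY (fun _ => ler01).
by rewrite expectation_cst => -[]; under eq_bigr do rewrite mul1r.
Qed.

Lemma expectation_le_affine (F : finType) (Y : Omega -> F) (f g : F -> R)
    (a b c : R) :
  (forall y, measurable [set w | Y w = y]%classic) ->
  (forall y, 0 <= f y) -> (forall y, 0 <= g y) -> 0 <= a ->
  (forall y, g y <= a * f y + b) ->
  ('E_P[fun w => f (Y w)] <= c%:E)%E ->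
  ('E_P[fun w => g (Y w)] <= (a * c + b)%:E)%E.
Proof.
move=> mY f0 g0 a0 gf; rewrite !expectation_finite_valued // !lee_fin => fc.
apply: (@le_trans _ _
  (\sum_y (a * f y + b) * fine (P [set w | Y w = y]%classic))).
  by apply: ler_sum => y _; rewrite ler_wpM2r // fine_ge0.
under eq_bigr do rewrite mulrDl -mulrA; rewrite big_split -!mulr_sumr /=.
by rewrite sum_finite_valued_probability // mulr1 lerD2r ler_wpM2l.
Qed.

End FiniteValuedExpectation.

Section History.
Context {R : realType} {n : nat} {disp : measure_display}
  {Omega : measurableType disp} {P : probability Omega R}
  {T : {set {set 'I_n}}} {tau : nat -> Omega -> {set 'I_n}}
  (iid : iid_uniform P T tau).

(** The iterate after [j] steps is a function of the first [j] blocks, a random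
    variable with values in a finite type; this makes all the expectations
    finite sums. *)
Definition history j w : j.-tuple {set 'I_n} := [tuple tau (val i) w | i < j].

Lemma nth_history j w i : (i < j)%N -> nth finset.set0 (history j w) i = tau i w.
Proof.
move=> ij; rewrite -{1}(_ : val (Ordinal ij) = i) //.
by rewrite -tnth_nth tnth_mktuple.
Qed.

Lemma historyE j (s : j.-tuple {set 'I_n}) (B : nat -> {set {set 'I_n}}) :
  (forall i, (i < j)%N -> B i = [set nth finset.set0 s i]%SET) ->
  [set w | history j w = s]%classic =
  [set w | forall i, i \in iota 0 j -> tau i w \in B i]%classic.
Proof.
move=> hB; apply/seteqP; split=> w /= h.
  move=> i; rewrite mem_iota /= => ij.
  by rewrite hB // finset.inE -(nth_history w ij) h.
apply/val_inj/(@eq_from_nth _ finset.set0); rewrite !size_tuple // => i ij.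
rewrite nth_history //; have := h i; rewrite mem_iota ij => /(_ isT).
by rewrite hB // finset.inE => /eqP.
Qed.

Lemma measurable_history j s : measurable [set w | history j w = s]%classic.
Proof.
have [mtau _ _] := iid.
rewrite (_ : [set _ | _]%classic =
    \bigcap_(i in [set i | (i < j)%N])
      [set w | tau i w = nth finset.set0 s i])%classic.
  by apply: fin_bigcap_measurable => [|i _]; [exact: finite_II | exact: mtau].
apply/seteqP; split=> w /= h.
  by move=> i ij /=; rewrite -h nth_history.
apply/val_inj/(@eq_from_nth _ finset.set0); rewrite !size_tuple // => i ij.
by rewrite nth_history // h.
Qed.

Lemma history_indep j t s :
  (P [set w | (tau j w, history j w) = (t, s)]%classic =
   P [set w | tau j w = t]%classic * P [set w | history j w = s]%classic)%E.
Proof.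
have [_ _ ind] := iid.
(* Both the past and the past with the next block are cylinder events of this
   one family, so that the product formula applies to each. *)
pose B i := [set nth finset.set0 (rcons s t) i]%SET.
have hB i : (i < j)%N -> B i = [set nth finset.set0 s i]%SET.
  by move=> ij; rewrite /B nth_rcons size_tuple ij.
have Bj : B j = [set t]%SET by rewrite /B nth_rcons size_tuple ltnn eqxx.
rewrite (historyE hB) (ind _ B (iota_uniq 0 j)) muleC.
have -> : [set w | (tau j w, history j w) = (t, s)]%classic =
    [set w | forall i, i \in iota 0 j.+1 -> tau i w \in B i]%classic.
  rewrite -addn1 iotaD; apply/seteqP; split=> w /=.
    move=> [jt hs] i; rewrite mem_cat => /orP[].
      have : [set w | history j w = s]%classic w by [].
      by rewrite (historyE hB); exact.
    by rewrite finset.inE => /eqP ->; rewrite Bj finset.inE jt.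
  move=> h; have -> : tau j w = t.
    apply/eqP; have := h j.
    by rewrite Bj finset.inE mem_cat mem_head orbT; exact.
  congr pair.
  have : [set w | forall i, i \in iota 0 j -> tau i w \in B i]%classic w.
    by move=> i ij; apply: h; rewrite mem_cat ij.
  by rewrite -(historyE hB).
rewrite (ind _ B (iota_uniq 0 j.+1)) -addn1 iotaD big_cat big_seq1.
congr (_ * P _)%E; apply/seteqP; split=> w /=; rewrite Bj finset.inE => /eqP //.
Qed.

(** [iid_uniform] gives the probability of the blocks of [T] only.  The other
    sets have probability zero because those of [T] already add up to one. *)
Lemma block_probability j t : (0 < #|T|)%N ->
  fine (P [set w | tau j w = t]%classic) = if t \in T then #|T|%:R^-1 else 0.
Proof.
move=> T0; have [mtau unif _] := iid.
pose p t := fine (P [set w | tau j w = t]%classic).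
have p0 u : 0 <= p u by exact: fine_ge0.
have pT u : u \in T -> p u = #|T|%:R^-1 by rewrite /p => /(unif j) ->.
rewrite -/(p t); case: ifPn => [/pT //|tT].
have := sum_finite_valued_probability P (mtau j).
rewrite (bigID (fun u => u \in T)) /= (eq_bigr _ pT).
rewrite sumr_const -[X in X + _]mulr_natl.
rewrite divff ?pnatr_eq0 -?lt0n // => h.
have : \sum_(u | u \notin T) p u = 0 by rewrite /p; lra.
by move=> /(psumr_eq0P (fun i _ => p0 i)); apply.
Qed.

(** Conditioning on the past: as the next block is independent of the past and
    uniform, it can be averaged out first. *)
Lemma expectation_next_block j (h : {set 'I_n} -> j.-tuple {set 'I_n} -> R) :
  (0 < #|T|)%N -> (forall t s, 0 <= h t s) ->
  ('E_P[fun w => h (tau j w) (history j w)] =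
   'E_P[fun w => (#|T|%:R^-1 * \sum_(t in T) h t (history j w))%R])%E.
Proof.
move=> T0 h0; have [mtau _ _] := iid.
rewrite (expectation_finite_valued P (Y := fun w => (tau j w, history j w))
  (g := fun y => h y.1 y.2)) //; last first.
  move=> [t s]; rewrite (_ : [set _ | _]%classic =
    ([set w | tau j w = t] `&` [set w | history j w = s])%classic).
    by apply: measurableI; [exact: mtau | exact: measurable_history].
  by apply/seteqP; split=> w /= => [[-> ->]|[-> ->]].
rewrite (expectation_finite_valued P (Y := history j)
  (g := fun s => #|T|%:R^-1 * \sum_(t in T) h t s)) //; last 2 first.
- exact: measurable_history.
- by move=> s; rewrite mulr_ge0 ?invr_ge0 ?sumr_ge0.
congr EFin; transitivity (\sum_t \sum_s h t s *
  fine (P [set w | (tau j w, history j w) = (t, s)]%classic)).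
  by rewrite pair_bigA; apply: eq_bigr => -[t s].
rewrite exchange_big /=.
apply: eq_bigr => s _; rewrite mulr_sumr mulr_suml [RHS]big_mkcond.
apply: eq_bigr => t _.
rewrite history_indep fineM ?fin_num_measure //; rewrite ?mtau //; last first.
  exact: measurable_history.
rewrite block_probability //; case: ifP => _; ring.
Qed.

End History.

(** * Convergence in expectation *)

Lemma eq_block_kaczmarz (R : realType) (k : scalar_kind) n d
    (A : 'M[scalars R k]_(n, d)) b x0 (u v : nat -> {set 'I_n}) j :
  (forall i, (i < j)%N -> u i = v i) ->
  block_kaczmarz A b x0 u j = block_kaczmarz A b x0 v j.
Proof.
elim: j => //= j IHj uv; rewrite IHj ?uv // => i ij.
by apply: uv; rewrite ltnS ltnW.
Qed.

Lemma block_kaczmarz_history (R : realType) (k : scalar_kind) n d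
    (A : 'M[scalars R k]_(n, d)) b x0 (disp : measure_display)
    (Omega : measurableType disp) (tau : nat -> Omega -> {set 'I_n}) j w :
  block_kaczmarz A b x0 (fun i => tau i w) j =
  block_kaczmarz A b x0 (nth finset.set0 (history (tau := tau) j w)) j.
Proof. by apply: eq_block_kaczmarz => i ij; rewrite nth_history. Qed.

Unset Implicit Arguments.

Theorem theorem1p2 (R : realType) (k : scalar_kind) (n d m : nat)
    (A : 'M[scalars R k]_(n, d)) (b : 'cV[scalars R k]_n)
    (alpha beta : R) (T : {set {set 'I_n}})
    (xstar x0 : 'cV[scalars R k]_d)
    (disp : measure_display) (Omega : measurableType disp)
    (P : probability Omega R) (tau : nat -> Omega -> {set 'I_n})
    (hrank : \rank A = d)
    (hpaving : row_paving A m alpha beta T)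
    (halpha : 0 < alpha)
    (hxstar : least_squares_minimizer A b xstar)
    (htau : iid_uniform P T tau)
    (j : nat) :
  let e := A *m xstar - b in
  ('E_P[fun w => sqnorm (block_kaczmarz A b x0 (fun i => tau i w) j - xstar)]
   <= ((1 - sigma_min A ^+ 2 / (beta * m%:R)) ^+ j * sqnorm (x0 - xstar)
       + beta / alpha * (sqnorm e / sigma_min A ^+ 2))%:E)%E.
Proof.
cbv zeta; set e := A *m xstar - b; have [d0|d0] := posnP d.
  (* There is no column, so every error vanishes.  The second term on the right
     vanishes as well: [sigma_min A] takes its default value 0, and so does the
     quotient by its square. *)
  have sq0 (v : 'cV[scalars R k]_d) : sqnorm v = 0.
    by apply: big1 => -[i id] _; exfalso; move: id; rewrite d0.
  have s0 : sigma_min A = 0.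
    by rewrite /sigma_min nth_default ?raddf0 // size_singular_values d0.
  rewrite s0 expr0n invr0 !mulr0 sq0 mulr0 addr0.
  rewrite (_ : (fun _ => _) = cst 0); last by apply: funext => w; rewrite sq0.
  by rewrite expectation_cst.
have [m0 beta0] := paving_gt0 hrank halpha d0 hpaving.
have q0 := contraction_factor_ge0 hrank halpha d0 hpaving.
have step := kaczmarz_step_average hrank halpha d0 hpaving b ^~ xstar.
have m0' : 0 < m%:R :> R by rewrite ltr0n.
have s0 : sigma_min A != 0 by rewrite -sqrf_eq0 gt_eqF // sigma_min_gt0.
set C := beta / alpha * _.
have C0 : 0 <= C by rewrite mulr_ge0 ?divr_ge0 ?sqnorm_ge0 ?sqr_ge0 // ltW.
have Cfix : (1 - sigma_min A ^+ 2 / (beta * m%:R)) * C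
    + sqnorm e / (alpha * m%:R) = C.
  by rewrite /C; field; rewrite s0 !gt_eqF.
set q := 1 - _ in q0 step Cfix *.
have [_ cT _] := hpaving; have T0 : (0 < #|T|)%N by rewrite cT.
elim: j => [|j IHj].
  rewrite -[X in expectation P X]/(cst (sqnorm (x0 - xstar))) expectation_cst.
  by rewrite lee_fin expr0 mul1r lerDl.
pose X (s : j.-tuple {set 'I_n}) := block_kaczmarz A b x0 (nth finset.set0 s) j.
pose H := history (tau := tau) j.
have XE w : block_kaczmarz A b x0 (fun i => tau i w) j = X (H w).
  exact: block_kaczmarz_history.
pose f s := sqnorm (X s - xstar).
pose h t s := sqnorm (kaczmarz_step A b t (X s) - xstar).
have -> : (fun w => sqnorm
    (block_kaczmarz A b x0 (fun i => tau i w) j.+1 - xstar)) =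
    fun w => h (tau j w) (H w).
  by apply: funext => w; rewrite /h -XE.
have h0 t s : 0 <= h t s by exact: sqnorm_ge0.
rewrite (expectation_next_block htau T0 h0) cT.
have IH : ('E_P[fun w => f (H w)] <= (q ^+ j * sqnorm (x0 - xstar) + C)%:E)%E.
  by rewrite /f; under eq_fun do rewrite -XE.
have -> : q ^+ j.+1 * sqnorm (x0 - xstar) + C =
    q * (q ^+ j * sqnorm (x0 - xstar) + C) + sqnorm e / (alpha * m%:R).
  by rewrite mulrDr -addrA Cfix mulrA -exprS.
apply: (expectation_le_affine (measurable_history htau (j := j))
  (fun s => sqnorm_ge0 _) _ q0 (fun s => step (X s)) IH) => s.
by apply: mulr_ge0; [rewrite invr_ge0 | apply: sumr_ge0 => t _; exact: h0].
Qed.
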